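(* Two computable probability measures on a constructive metric space are orthogonal if and only if they are effectively orthogonal.
   Context: A constructive metric space $(X,d,D,\alpha)$ is a complete separable metric space $(X,d)$ with a countable dense set $D$ and a numbering $\alpha:\mathbb{N}\to D$ such that $d(\alpha(m),\alpha(n))$ is computable uniformly in $m,n$. Basic balls are open balls with centres in $D$ and rational radii; effectively open sets are unions of enumerable families of basic balls. The probability measures $\mathcal{M}(X)$ form a constructive metric space with the Prokhorov distance and dense set the rational-valued measures with finite support in $D$ (naturally numbered); computable measures are computable points of this space (e.g. points for which the set of basic balls containing them is enumerable). A function $f:X\times\mathcal{M}(X)\to[0,\infty]$ is lower semicomputable if each $\{f>r\}$, $r$ rational, is a union of an enumerable family of products of basic balls, uniformly in $r$. A uniform test is such $f$ with $\int f(x,P)\,dP(x)\le1$ for all $P$; for a universal (maximal up to a constant factor) uniform test $\mathbf{t}$, $x$ is uniformly random w.r.t. $P$ if $\mathbf{t}(x,P)<\infty$. Measures $P,Q$ are orthogonal if $X$ splits into disjoint Borel sets $U,V$ with $P(V)=Q(U)=0$; they are effectively orthogonal if no point is uniformly random with respect to both. *)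

(* Defs.v *)
From HB Require Import structures.
From mathcomp Require Import all_boot all_order all_algebra.
From mathcomp Require Import all_classical all_reals all_analysis.

Set Implicit Arguments.
Unset Strict Implicit.
Unset Printing Implicit Defensive.

Import Order.TTheory GRing.Theory Num.Theory.
Import numFieldNormedType.Exports.

Local Open Scope classical_set_scope.
Local Open Scope ring_scope.

(* Total recursive functions of k arguments: minimisation is only applied to
   functions that have a zero for every value of the parameters. *)
Inductive recursive : forall k, (k.-tuple nat -> nat) -> Prop :=
| rec_zero : recursive (fun _ : 0.-tuple nat => 0%N)
| rec_succ : recursive (fun v : 1.-tuple nat => (thead v).+1)
| rec_proj k (i : 'I_k) : recursive (fun v : k.-tuple nat => tnth v i)
| rec_comp k m (f : m.-tuple nat -> nat) (g : 'I_m -> k.-tuple nat -> nat) :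
    recursive f -> (forall i, recursive (g i)) ->
    recursive (fun v : k.-tuple nat => f [tuple g i v | i < m])
| rec_prec k (f : k.-tuple nat -> nat) (g : k.+2.-tuple nat -> nat)
    (h : k.+1.-tuple nat -> nat) :
    recursive f -> recursive g ->
    (forall v : k.-tuple nat, h [tuple of 0%N :: v] = f v) ->
    (forall n (v : k.-tuple nat), h [tuple of n.+1 :: v] =
       g [tuple of n :: h [tuple of n :: v] :: v]) ->
    recursive h
| rec_min k (f : k.+1.-tuple nat -> nat) (h : k.-tuple nat -> nat) :
    recursive f ->
    (forall v : k.-tuple nat, f [tuple of h v :: v] = 0%N) ->
    (forall (v : k.-tuple nat) n, (n < h v)%N -> f [tuple of n :: v] <> 0%N) ->
    recursive h.

(* Empty, or the range of a sequence of tuples with recursive coordinates. *)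
Definition enumerable k (A : set (k.-tuple nat)) : Prop :=
  A = set0 \/
  exists f : 'I_k -> 1.-tuple nat -> nat, (forall i, recursive (f i)) /\
    A = range (fun n : nat => [tuple f i [tuple n] | i < k]).

(* A surjective, non-injective numbering of the rationals: the code of
   [:: a; b; c] denotes (a - b) / (c + 1).  CodeSeq.decode is a computable
   bijection from nat onto seq nat. *)
Definition rat_num (n : nat) : rat :=
  let s := CodeSeq.decode n in
  ((nth 0%N s 0)%:R - (nth 0%N s 1)%:R) / (nth 0%N s 2).+1%:R.

Definition computable_reals (R : realType) k (u : k.-tuple nat -> R) : Prop :=
  exists f : k.+1.-tuple nat -> nat, recursive f /\
    forall p (v : k.-tuple nat), `|u v - ratr (rat_num (f [tuple of p :: v]))| <= 2 ^- p.

(* Complete includes a distinguished point; it carries no content, since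
   ideal 0 exists anyway. *)
HB.mixin Record isConstructiveMetric (R : realType) X
    & Metric R X & Complete X := {
  ideal : nat -> X ;
  ideal_dense : dense (range ideal) ;
  ideal_computable : computable_reals (fun v : 2.-tuple nat =>
    mdist (ideal (tnth v ord0)) (ideal (tnth v ord_max)) : R)
}.

#[short(type="constructiveMetricType")]
HB.structure Definition ConstructiveMetric (R : realType) :=
  { X of Metric R X & Complete X & isConstructiveMetric R X }.

Section constructive_metric.
Context {R : realType} (X : constructiveMetricType R).

Definition borel := g_sigma_algebraType (@open X).

Definition prob := probability borel R.

Definition thickening (e : R) (A : set X) : set X :=
  [set x | exists2 y, A y & mdist x y < e].

(* The defining condition of this set is symmetric in P and Q.  Thickenings
   are open, hence measurable, and e = 1 always belongs to the set. *)
Definition prokhorov (P Q : prob) : R :=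
  inf [set e : R | 0 < e /\ forall A : set borel, measurable A ->
         (P A <= Q (thickening e A) + e%:E)%E].

(* If decode n = [:: w_0; ...; w_(k-1)] is not identically zero, this is the
   measure giving the ideal point i the weight w_i / (w_0 + ... + w_(k-1));
   otherwise it is the Dirac measure at ideal 0.  Every rational-valued
   probability measure with finite support in the range of ideal is reached. *)
Definition ideal_prob (n : nat) : prob :=
  let w := CodeSeq.decode n in
  mnormalize
    (msum (fun i => mscale ((nth 0%N w i)%:R)%:nng
                      (dirac (ideal i : borel))) (size w))
    (dirac (ideal 0 : borel)).

(* A nonpositive radius gives the empty ball. *)
Definition basic_ball (T : Type) (dist : T -> T -> R) (c : nat -> T)
    (i q : nat) : set T :=
  [set x | dist (c i) x < ratr (rat_num q)].

Definition computable_point (T : Type) (dist : T -> T -> R) (c : nat -> T)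
    (x : T) : Prop :=
  enumerable [set v : 2.-tuple nat |
    basic_ball dist c (tnth v ord0) (tnth v ord_max) x].

Definition computable_prob (P : prob) : Prop :=
  computable_point prokhorov ideal_prob P.

Definition lower_semicomputable (f : X -> prob -> \bar R) : Prop :=
  (forall x P, 0 <= f x P)%E /\
  exists E : set (5.-tuple nat), enumerable E /\
    forall (r : nat) x P, ((ratr (rat_num r))%:E < f x P)%E <->
      exists i q j s, [/\ E [tuple r; i; q; j; s],
        basic_ball (fun y z : X => mdist y z) ideal i q x &
        basic_ball prokhorov ideal_prob j s P].

Definition uniform_test (f : X -> prob -> \bar R) : Prop :=
  lower_semicomputable f /\
  forall P : prob, (\int[P]_(x in [set: borel]) f x P <= 1)%E.

Definition universal_uniform_test (t : X -> prob -> \bar R) : Prop :=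
  uniform_test t /\
  forall f, uniform_test f ->
    exists2 c : R, 0 < c & forall x P, (f x P <= c%:E * t x P)%E.

(* Meant for a universal t.  Two universal tests agree up to a positive
   constant factor, so the notion does not depend on the choice of t. *)
Definition uniformly_random (t : X -> prob -> \bar R) (x : X) (P : prob) :
    Prop :=
  (t x P < +oo)%E.

Definition orthogonal_prob (P Q : prob) : Prop :=
  exists U V : set borel, [/\ measurable U, measurable V,
    U `&` V = set0, U `|` V = setT & P V = 0%E /\ Q U = 0%E].

Definition effectively_orthogonal (t : X -> prob -> \bar R) (P Q : prob) :
    Prop :=
  forall x : X, ~ (uniformly_random t x P /\ uniformly_random t x Q).

End constructive_metric.

(* Main.v *)
Require Import Defs.
From mathcomp Require Import all_boot all_order all_algebra.
From mathcomp Require Import all_classical all_reals all_analysis.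
From mathcomp Require Import measurable_realfun zify lra.

(** [<=]: a uniform test is finite almost everywhere, so the points that are
    not random for [P] form a [P]-null Borel set whose complement is [Q]-null.

    [=>]: let [V] be Borel with [P V = 0] and [Q V = 1].  By inner regularity
    some closed [C] in [V] has almost full [Q]-measure while its thickenings
    have small [P]-measure, and finitely many small balls centred at ideal
    points near [C] cover almost all of [Q].  Hence for every [n] there are
    centres [c_0, ..., c_(K-1)], a radius [2^-m], and ideal measures close to
    [P] and to [Q] which witness that little of the [P]-mass lies within
    [10 * 2^-m] of the centres and little of the [Q]-mass lies further than
    [2 * 2^-m] from all of them; since ideal measures are finite weighted sums
    this is decidable up to the precision of the approximate distances, and
    unbounded search finds such data for each [n] recursively.  The balls around
    ideal points within about [6 * 2^-m] of the centres, and the balls around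
    the other ideal points, cover [X].  The bound on the former holds not only
    for [P] but on the whole Prokhorov ball around [P] that has been found, so
    [x, P' |-> sup {n | x is in the n-th set and P' in the n-th ball}] is a
    uniform test even though [P'] is arbitrary; likewise for the latter and [Q].
    Every [x] is in infinitely many sets of one of the two kinds. *)

Set Implicit Arguments.
Unset Strict Implicit.
Unset Printing Implicit Defensive.

Local Open Scope classical_set_scope.

(** * Recursive functions *)

(* Recursive functions of [k] arguments, presented on sequences so that binding
   a further variable is consing it in front of the arguments. *)
Definition rc k (F : seq nat -> nat) :=
  recursive (fun v : k.-tuple nat => F v).

Lemma rc_ext k (F G : seq nat -> nat) :
  (forall s, size s = k -> F s = G s) -> rc k F -> rc k G.
Proof.
move=> FG; rewrite /rc; congr recursive; apply/funext => v.
by rewrite FG// size_tuple.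
Qed.

Lemma recursive_rc k (f : k.-tuple nat -> nat) (F : seq nat -> nat) :
  (forall v : k.-tuple nat, f v = F v) -> recursive f -> rc k F.
Proof. by move=> fF; rewrite /rc (_ : f = (fun v => F v))//; apply/funext. Qed.

Lemma rc_var k i : i < k -> rc k (fun s => nth 0 s i).
Proof.
move=> ik; apply: (recursive_rc (f := fun v => tnth v (Ordinal ik))).
  by move=> v; rewrite (tnth_nth 0).
exact: rec_proj.
Qed.

Lemma rc_comp k (Gs : seq (seq nat -> nat)) F : rc (size Gs) F ->
  (forall i, i < size Gs -> rc k (nth (fun=> 0) Gs i)) ->
  rc k (fun s => F [seq G s | G <- Gs]).
Proof.
move=> rF rG.
have := rec_comp rF (fun i : 'I_(size Gs) => rG i (ltn_ord i)).
apply: recursive_rc => v /=; congr F.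
apply: (@eq_from_nth _ 0); rewrite ?size_map -?enumT ?size_enum_ord// => i iGs.
rewrite (nth_map (fun=> 0))// -[i]/(val (Ordinal iGs)).
by rewrite -(tnth_nth 0 (mktuple _)) tnth_mktuple.
Qed.

Lemma rc_comp1 k F G : rc 1 F -> rc k G -> rc k (fun s => F [:: G s]).
Proof. by move=> rF rG; apply: (rc_comp (Gs := [:: G])) => // -[]. Qed.

Lemma rc_comp2 k F G H : rc 2 F -> rc k G -> rc k H ->
  rc k (fun s => F [:: G s; H s]).
Proof. by move=> rF rG rH; apply: (rc_comp (Gs := [:: G; H])) => // -[|[]]. Qed.

Lemma rc_comp3 k F G H I : rc 3 F -> rc k G -> rc k H -> rc k I ->
  rc k (fun s => F [:: G s; H s; I s]).
Proof.
by move=> *; apply: (rc_comp (Gs := [:: G; H; I])) => // -[|[|[]]].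
Qed.

Lemma rc_cons k F N : rc k.+1 F -> rc k N -> rc k (fun s => F (N s :: s)).
Proof.
move=> rF rN; pose Gs := N :: [seq nth 0^~ i | i <- iota 0 k].
have sGs : size Gs = k.+1 by rewrite /= size_map size_iota.
apply: (rc_ext (F := fun s => F [seq G s | G <- Gs])) => [s sk|].
  by rewrite /= -map_comp -sk -[X in _ = F (_ :: X)](mkseq_nth 0).
apply: rc_comp; rewrite sGs// => -[//|i] ik /=.
rewrite (nth_map 0) ?size_iota// nth_iota//; exact: rc_var.
Qed.

Lemma rc_succ k F : rc k F -> rc k (fun s => (F s).+1).
Proof.
apply: (rc_comp1 (F := fun s => (nth 0 s 0).+1)).
by apply: recursive_rc rec_succ => v; rewrite /thead (tnth_nth 0).
Qed.

Lemma rc_const k n : rc k (fun=> n).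
Proof.
elim: n => [|n IHn]; last exact: rc_succ.
apply: (rc_comp (Gs := [::]) (F := fun=> 0)) => //; exact: rec_zero.
Qed.

Lemma rc_prec k B S N : rc k B -> rc k.+2 S -> rc k N ->
  rc k (fun s => nat_rec _ (B s) (fun n r => S [:: n, r & s]) (N s)).
Proof.
move=> rB rS rN; apply: (rc_cons (F := fun s =>
  nat_rec _ (B (behead s)) (fun n r => S [:: n, r & behead s]) (head 0 s))) rN.
exact: rec_prec rB rS _ _.
Qed.

Lemma rc_min k T h : rc k.+1 T -> (forall s, size s = k ->
  T (h s :: s) = 0 /\ forall n, n < h s -> T (n :: s) <> 0) -> rc k h.
Proof.
move=> rT hT; apply: rec_min rT _ _ => v; have [] := hT v (size_tuple v) => //.
Qed.

Lemma rc_add k F G : rc k F -> rc k G -> rc k (fun s => F s + G s).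
Proof.
move=> rF rG; have rS : rc k.+2 (fun s => (nth 0 s 1).+1).
  by apply: rc_succ; apply: rc_var.
apply: rc_ext (rc_prec rF rS rG) => s _ /=.
by elim: (G s) => [|n /= ->]; rewrite ?addn0 ?addnS.
Qed.

Lemma rc_mul k F G : rc k F -> rc k G -> rc k (fun s => F s * G s).
Proof.
move=> rF rG; apply: (rc_comp2 (F := fun s => nth 0 s 0 * nth 0 s 1)) rF rG.
have rS : rc 4 (fun s => nth 0 s 1 + nth 0 s 2) by apply: rc_add; exact: rc_var.
have r0 := rc_const 2 0; have r1 : rc 2 (nth 0^~ 1) by exact: rc_var.
apply: rc_ext (rc_prec r0 rS r1) => s _ /=.
by elim: (nth 0 s 1) => [|n /= ->]; rewrite ?muln0 ?mulnS// addnC.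
Qed.

Lemma rc_pred k F : rc k F -> rc k (fun s => (F s).-1).
Proof.
move=> rF; have rS : rc k.+2 (nth 0^~ 0) by exact: rc_var.
by apply: rc_ext (rc_prec (rc_const k 0) rS rF) => s _ /=; case: (F s).
Qed.

Lemma rc_sub k F G : rc k F -> rc k G -> rc k (fun s => F s - G s).
Proof.
move=> rF rG; have rS : rc k.+2 (fun s => (nth 0 s 1).-1).
  by apply: rc_pred; exact: rc_var.
apply: rc_ext (rc_prec rF rS rG) => s _ /=.
by elim: (G s) => [|n /= ->]; rewrite ?subn0 ?subnS.
Qed.

Lemma rc_exp k b F : rc k F -> rc k (fun s => b ^ F s).
Proof.
move=> rF; have rS : rc k.+2 (fun s => nth 0 s 1 * b).
  by apply: rc_mul; [exact: rc_var|exact: rc_const].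
apply: rc_ext (rc_prec (rc_const k 1) rS rF) => s _ /=.
by elim: (F s) => [|n /= ->]; rewrite ?expn0 ?expnSr.
Qed.

Definition rcb k (B : seq nat -> bool) := rc k (fun s => B s).

Lemma rcb_leq k F G : rc k F -> rc k G -> rcb k (fun s => F s <= G s).
Proof.
move=> rF rG; apply: rc_ext (rc_sub (rc_const k 1) (rc_sub rF rG)) => s _.
by rewrite /leq; case: (F s - G s).
Qed.

Lemma rcb_and k B C : rcb k B -> rcb k C -> rcb k (fun s => B s && C s).
Proof. by move=> rB rC; apply: rc_ext (rc_mul rB rC) => s _; rewrite mulnb. Qed.

Lemma rcb_not k B : rcb k B -> rcb k (fun s => ~~ B s).
Proof.
by move=> rB; apply: rc_ext (rc_sub (rc_const k 1) rB) => s _; case: (B s).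
Qed.

Lemma rcb_or k B C : rcb k B -> rcb k C -> rcb k (fun s => B s || C s).
Proof.
move=> rB rC; apply: rc_ext (rcb_not (rcb_and (rcb_not rB) (rcb_not rC))) => s _.
by rewrite negb_and !negbK.
Qed.

Lemma rcb_eq k F G : rc k F -> rc k G -> rcb k (fun s => F s == G s).
Proof.
move=> rF rG; apply: rc_ext (rcb_and (rcb_leq rF rG) (rcb_leq rG rF)) => s _.
by rewrite eqn_leq.
Qed.

Lemma rc_if k B F G : rcb k B -> rc k F -> rc k G ->
  rc k (fun s => if B s then F s else G s).
Proof.
move=> rB rF rG.
apply: rc_ext (rc_add (rc_mul rB rF) (rc_mul (rcb_not rB) rG)) => s _.
by case: (B s); rewrite /= ?mul1n ?mul0n ?addn0.
Qed.

Lemma rc_drop k n m F : rc k.+1 F -> n < m ->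
  rc (m + k) (fun s => F (nth 0 s n :: drop m s)).
Proof.
move=> rF nm.
pose Gs := nth 0^~ n :: [seq nth 0^~ i | i <- iota m k].
have sGs : size Gs = k.+1 by rewrite /= size_map size_iota.
apply: (rc_ext (F := fun s => F [seq G s | G <- Gs])) => [s sk|].
  rewrite /= -map_comp; congr (F (_ :: _)).
  apply: (@eq_from_nth _ 0); rewrite size_map size_iota ?size_drop ?sk ?addKn// => i ik.
  by rewrite (nth_map 0) ?size_iota//= nth_iota// nth_drop.
apply: rc_comp; rewrite sGs// => -[|i] ik /=.
  by apply: rc_var; rewrite ltn_addr.
by rewrite (nth_map 0) ?size_iota// nth_iota//; apply: rc_var; rewrite ltn_add2l.
Qed.

Lemma rc_sum k N F : rc k N -> rc k.+1 F ->
  rc k (fun s => \sum_(0 <= i < N s) F (i :: s)).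
Proof.
move=> rN rF.
have rS : rc k.+2 (fun s => nth 0 s 1 + F (nth 0 s 0 :: drop 2 s)).
  apply: rc_add; first exact: rc_var.
  exact: (rc_drop (m := 2)).
apply: rc_ext (rc_prec (rc_const k 0) rS rN) => s _ /=.
elim: (N s) => [|n /= ->]; first by rewrite big_geq.
by rewrite big_nat_recr//= drop0.
Qed.

Lemma rcb_has k N B : rc k N -> rcb k.+1 B ->
  rcb k (fun s => has (fun i => B (i :: s)) (iota 0 (N s))).
Proof.
move=> rN rB; apply: rc_ext (rcb_leq (rc_const k 1) (rc_sum rN rB)) => s _.
congr nat_of_bool; rewrite /index_iota subn0 lt0n sum_nat_seq_neq0.
by apply: eq_has => i /=; case: (B _).
Qed.

Lemma decode_cons h t : CodeSeq.decode (2 ^ h * t.*2.+1) = h :: CodeSeq.decode t.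
Proof. by rewrite -{1}[t]CodeSeq.decodeK -[RHS]CodeSeq.codeK. Qed.

Lemma codeE n : 0 < n -> exists h t, n = 2 ^ h * t.*2.+1.
Proof.
rewrite -{1 2}[n]CodeSeq.decodeK; case: CodeSeq.decode => [//|h s] _.
by exists h, (CodeSeq.code s).
Qed.

Lemma rc_code_head k F : rc k F -> rc k (fun s => head 0 (CodeSeq.decode (F s))).
Proof.
apply: (rc_comp1 (F := fun s => head 0 (CodeSeq.decode (nth 0 s 0)))).
pose B s := (nth 0 s 1 == 0) || has (fun t =>
  nth 0 s 1 == 2 ^ (nth 0 s 0) * (t + t).+1) (iota 0 (nth 0 s 1)).
have rB : rcb 2 B.
  apply: rcb_or; first by apply: rcb_eq; [exact: rc_var|exact: rc_const].
  apply: (rcb_has (B := fun s => nth 0 s 2 == 2 ^ nth 0 s 1 *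
    (nth 0 s 0 + nth 0 s 0).+1)); first exact: rc_var.
  apply: rcb_eq; first exact: rc_var.
  apply: rc_mul; first by apply: rc_exp; exact: rc_var.
  by apply: rc_succ; apply: rc_add; exact: rc_var.
apply: rc_min (rcb_not rB) _ => -[//|n []]//= _; split.
- rewrite /B/=; case: n => [//|n].
  have [h [t ->]] := @codeE n.+1 isT; rewrite decode_cons/=.
  set N := _ * _; suff -> : has (fun t => N == 2 ^ h * (t + t).+1) (iota 0 N) by rewrite orbT.
  apply/hasP; exists t; last by rewrite addnn.
  rewrite mem_iota /= add0n /N; have : 0 < 2 ^ h by rewrite expn_gt0.
  by nia.
- move=> e; rewrite /B/=; case: n => [//|n] eh; rewrite orFb.
  case: hasP => // -[t _ /eqP tn]; move: eh.
  by rewrite tn addnn decode_cons /= ltnn.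
Qed.

Lemma rc_code_behead k F : rc k F ->
  rc k (fun s => CodeSeq.code (behead (CodeSeq.decode (F s)))).
Proof.
apply: (rc_comp1 (F := fun s => CodeSeq.code (behead (CodeSeq.decode (nth 0 s 0))))).
pose B s := (nth 0 s 1 == 0) ||
  (nth 0 s 1 == 2 ^ (head 0 (CodeSeq.decode (nth 0 s 1))) * (nth 0 s 0 + nth 0 s 0).+1).
have rB : rcb 2 B.
  apply: rcb_or; first by apply: rcb_eq; [exact: rc_var|exact: rc_const].
  apply: rcb_eq; first exact: rc_var.
  apply: rc_mul; first by apply: rc_exp; apply: rc_code_head; exact: rc_var.
  by apply: rc_succ; apply: rc_add; exact: rc_var.
apply: rc_min (rcb_not rB) _ => -[//|n []]//= _; split.
- rewrite /B/=; case: n => [//|n].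
  have [h [t ->]] := @codeE n.+1 isT.
  by rewrite decode_cons/= CodeSeq.decodeK addnn eqxx orbT.
- move=> e; rewrite /B/=; case: n => [//|n] eh; rewrite orFb.
  case: eqP => // tn; move: eh.
  by rewrite {1}tn addnn decode_cons/= CodeSeq.decodeK ltnn.
Qed.

Lemma rc_nth k F I : rc k F -> rc k I ->
  rc k (fun s => nth 0 (CodeSeq.decode (F s)) (I s)).
Proof.
move=> rF rI; have rS : rc k.+2 (fun s =>
    CodeSeq.code (behead (CodeSeq.decode (nth 0 s 1)))).
  by apply: rc_code_behead; exact: rc_var.
apply: rc_ext (rc_code_head (rc_prec rF rS rI)) => s _.
rewrite -nth0 -[in RHS](addn0 (I s)) -nth_drop; congr (nth 0 _ 0) => /=.
elim: (I s) => [|n /= ->]; rewrite ?drop0 //.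
by rewrite CodeSeq.codeK -drop1 drop_drop add1n.
Qed.

Lemma enumerable_rc k B : rcb k.+1 B ->
  enumerable [set v : k.-tuple nat | exists n, B (n :: v)].
Proof.
move=> rB; set A := [set _ | _].
have [->|/set0P[v0 [n0 Bv0]]] := eqVneq A set0; first by left.
right; pose w s := [seq nth 0 (CodeSeq.decode (nth 0 s 0)) i | i <- iota 0 k.+1].
have rw : rcb 1 (fun s => B (w s)).
  pose Gs := [seq (fun s => nth 0 (CodeSeq.decode (nth 0 s 0)) i) | i <- iota 0 k.+1].
  have sGs : size Gs = k.+1 by rewrite size_map size_iota.
  apply: (rc_ext (F := fun s => B [seq G s | G <- Gs])) => [s _|].
    by rewrite -map_comp.
  have rB' : rc (size Gs) B by rewrite sGs.
  apply: (rc_comp rB') => i; rewrite sGs => ik.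
  rewrite (nth_map 0) ?size_iota// nth_iota//.
  by apply: rc_nth; [exact: rc_var|exact: rc_const].
pose f (i : nat) s := if B (w s) then nth 0 (w s) i.+1 else nth 0 v0 i.
exists (fun i (v : 1.-tuple nat) => f i v); split.
  move=> i; have rwi : rc 1 (fun s => nth 0 (w s) i.+1).
    apply: rc_ext (rc_nth (rc_var (ltn0Sn 0)) (rc_const 1 i.+1)).
    by move=> s _; rewrite (nth_map 0) ?size_iota ?nth_iota// ltnS.
  exact: rc_if rw rwi (rc_const 1 _).
apply/seteqP; split => [v [n Bnv]|_ [n _ <-]] /=.
- have wE : w [:: CodeSeq.code (n :: v)] = n :: v.
    transitivity (mkseq (nth 0 (n :: v)) k.+1).
      by rewrite -{2}(CodeSeq.codeK (n :: v)).
    by rewrite -[RHS](mkseq_nth 0)/= size_tuple.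
  exists (CodeSeq.code (n :: v)) => //; apply/eq_from_tnth => i.
  by rewrite tnth_mktuple /f wE Bnv (tnth_nth 0).
- rewrite /A /=; set ww := w [:: n].
  case: (boolP (B ww)) => Bw.
  + exists (nth 0 ww 0).
    suff <- : ww = nth 0 ww 0 :: [tuple f i [:: n] | i < k] by [].
    have sw : size ww = k.+1 by rewrite size_map size_iota.
    apply: (@eq_from_nth _ 0); first by rewrite sw -[RHS]/(size _).+1 size_tuple.
    case=> [//|i]; rewrite sw ltnS => ik.
    rewrite [RHS]/= -(tnth_nth 0 (mktuple _) (Ordinal ik)) tnth_mktuple /f.
    by rewrite -/ww Bw.
  + exists n0.
    have E : [tuple f i [:: n] | i < k] = v0.
      apply/eq_from_tnth => i; rewrite tnth_mktuple /f -/ww (negPf Bw).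
      by rewrite (tnth_nth 0).
    exact: (eq_ind_r (fun v : k.-tuple nat => B (n0 :: v)) Bv0 E).
Qed.

(** * Prokhorov distance and ideal measures *)

Import Order.TTheory GRing.Theory Num.Theory.
Import numFieldNormedType.Exports.
Local Open Scope ring_scope.

Section prokhorov.
Context {R : realType} (X : constructiveMetricType R).
Implicit Types (P Q : prob X) (x y z : X) (A B : set (borel X)).

Lemma open_mdist_ball x (e : R) : open [set y : X | mdist x y < e].
Proof.
rewrite openE => y /= xy; apply/nbhs_ballP; exists (e - mdist x y) => /=.
  by rewrite subr_gt0.
rewrite ballEmdist => z /= yz; apply: le_lt_trans (metric_triangle _ y _) _.
by rewrite -ltrBrDl.
Qed.

Lemma open_measurable_borel (A : set X) : open A -> measurable (A : set (borel X)).
Proof. exact: sub_sigma_algebra. Qed.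

Lemma closed_measurable_borel (A : set X) :
  closed A -> measurable (A : set (borel X)).
Proof.
by move=> /closed_openC/open_measurable_borel/measurableC; rewrite setCK.
Qed.

Lemma open_thickening e (A : set X) : open (thickening e A).
Proof.
rewrite (_ : thickening e A = \bigcup_(y in A) [set x | mdist y x < e]).
  by apply: bigcup_open => y _; exact: open_mdist_ball.
by apply/seteqP; split=> x [y Ay /= xy]; exists y => //=; rewrite metric_sym.
Qed.

Lemma measurable_thickening e A : measurable (thickening e A : set (borel X)).
Proof. exact: open_measurable_borel (open_thickening _ _). Qed.

Lemma thickening_sub (d e : R) (A : set X) : d <= e ->
  thickening d A `<=` thickening e A.
Proof. by move=> de x [y Ay xy]; exists y => //; exact: lt_le_trans de. Qed.

Lemma ideal_approx x (e : R) : 0 < e -> exists i, mdist (ideal i : X) x < e.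
Proof.
move=> e0; have /= := @ideal_dense R X _ _ (open_mdist_ball x e).
have ne : [set y : X | mdist x y < e] !=set0 by exists x => /=; rewrite mdistxx.
by move=> /(_ ne)[y [/= xy [i _ iy]]]; exists i; rewrite iy metric_sym.
Qed.

Lemma prokhorov_lt P Q (s : R) : prokhorov P Q < s ->
  forall A, measurable A -> (P A <= Q (thickening s A) + s%:E)%E.
Proof.
rewrite /prokhorov; set S := (X in inf X) => PQs A mA.
have hS : has_inf S.
  split; last by exists 0 => e [/ltW].
  exists 1; split => // B mB; apply: le_trans (probability_le1 _ mB) _.
  by rewrite leeDr// measure_ge0.
have [e [e0 PQe] es] := inf_lt hS.1 PQs.
apply: le_trans (PQe _ mA) _; apply: leeD; last by rewrite lee_fin ltW.
rewrite le_measure ?inE//; try exact: measurable_thickening.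
exact: thickening_sub (ltW es).
Qed.

Lemma prokhorov_lt_sym P Q (s : R) : prokhorov P Q < s ->
  forall A, measurable A -> (Q A <= P (thickening s A) + s%:E)%E.
Proof.
move=> PQs A mA; set B := ~` thickening s A.
have mtA : measurable (thickening s A : set (borel X)).
  exact: measurable_thickening.
have mB : measurable (B : set (borel X)) by exact: measurableC.
have mtB : measurable (thickening s B : set (borel X)).
  exact: measurable_thickening.
have := prokhorov_lt PQs mB.
have : (Q (thickening s B) <= 1 - Q A)%E.
  rewrite -probability_setC// le_measure ?inE//; first exact: measurableC.
  by move=> x [y By xy] Ax; apply: By; exists x => //; rewrite metric_sym.
rewrite [P B]probability_setC//.
rewrite -(fineK (fin_num_measure P _ mtA)) -(fineK (fin_num_measure Q _ mA)).
rewrite -(fineK (fin_num_measure Q _ mtB)).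
by rewrite -!EFinB -!EFinD !lee_fin; lra.
Qed.

Lemma ideal_probE n A : let w := CodeSeq.decode n in
  let W := (\sum_(i < size w) nth 0 w i)%N in (0 < W)%N ->
  ideal_prob X n A =
    ((\sum_(i < size w) (nth 0 w i)%:R * \1_A (ideal i : borel X)) / W%:R : R)%:E.
Proof.
move=> w W W0.
rewrite /ideal_prob -/w; set m := msum _ _.
have E B : m B =
    (\sum_(i < size w) (nth 0 w i)%:R * \1_B (ideal i : borel X) : R)%:E.
  rewrite /m /= /msum /mscale -sumEFin; apply: eq_bigr => i _.
  by rewrite EFinM.
have ET : (\sum_(i < size w) (nth 0 w i)%:R * \1_setT (ideal i : borel X) : R) =
    W%:R.
  by rewrite natr_sum; apply: eq_bigr => i _; rewrite indicT mulr1.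
transitivity ((if (m setT == 0)%E || (m setT == +oo)%E
  then (fun A => \d_(ideal 0 : borel X) A)
  else (fun A => (m A * ((fine (m setT))^-1)%:E)%E)) A); first reflexivity.
rewrite (E setT) ET eqe pnatr_eq0 eqn0Ngt W0.
transitivity (m A * ((W%:R : R)^-1)%:E)%E; first reflexivity.
by rewrite E.
Qed.

Lemma measure_bigcup_approx P (F : nat -> set (borel X)) (e : R) :
  (forall i, measurable (F i)) -> 0 < e ->
  exists N, (P (\bigcup_i F i) < P (\bigcup_(i < N) F i) + e%:E)%E.
Proof.
move=> mF e0; pose G n := \bigcup_(i < n) F i.
have mG n : measurable (G n) by apply: bigcup_measurable.
have UG : \bigcup_n G n = \bigcup_i F i.
  apply/seteqP; split=> [x [n _ [i _ Fi]]|x [i _ Fi]]; first by exists i.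
  by exists i.+1 => //; exists i => /=.
have ndG : nondecreasing_seq G.
  by move=> m n mn; apply/subsetPset => x [i /= im Fi]; exists i => //=; exact: leq_trans mn.
have mU : measurable (\bigcup_n G n) by exact: bigcup_measurable.
have := nondecreasing_cvg_mu (mu := P) mG mU ndG; rewrite UG => PG.
have fU : P (\bigcup_i F i) \is a fin_num.
  by rewrite -UG; exact: fin_num_measure.
have : \forall n \near \oo, (P (\bigcup_i F i) - e%:E < (P \o G) n)%E.
  apply: (PG [set y | P (\bigcup_i F i) - e%:E < y]%E); apply: open_nbhs_nbhs; split => /=.
    exact: open_ereal_gt_ereal.
  by rewrite EFinN lteBlDr ?lteDl// lte_fin.
move=> [N _ /(_ N (leqnn N))] /= PN; exists N.
by rewrite -lteBlDr.
Qed.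

Lemma measure_bigcap_approx P (F : nat -> set (borel X)) (e : R) :
  (forall i, measurable (F i)) -> nonincreasing_seq F -> 0 < e ->
  exists N, forall n, (N <= n)%N -> (P (F n) < P (\bigcap_i F i) + e%:E)%E.
Proof.
move=> mF niF e0.
have mI : measurable (\bigcap_n F n) by exact: bigcap_measurable.
have F0 : (P (F 0%N) < +oo)%E.
  by rewrite (le_lt_trans (probability_le1 P (mF 0)))// ltry.
have PF := nonincreasing_cvg_mu F0 mF mI niF.
have : \forall n \near \oo, ((P \o F) n < P (\bigcap_i F i) + e%:E)%E.
  apply: (PF [set y | y < P (\bigcap_i F i) + e%:E]%E); apply: open_nbhs_nbhs; split => /=.
    exact: open_ereal_lt_ereal.
  by rewrite lteDl// ?lte_fin// fin_num_measure.
by move=> [N _ NP]; exists N => n /NP.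
Qed.

Lemma thickening_approx P (C : set X) (e : R) : closed C -> 0 < e ->
  exists M, forall m, (M <= m)%N ->
    (P (thickening (2 ^- m)%R C : set (borel X)) < P (C : set (borel X)) + e%:E)%E.
Proof.
move=> cC e0.
have niF : nonincreasing_seq (fun n => thickening (2 ^- n : R) C : set (borel X)).
  move=> m n mn; apply/subsetPset; apply: thickening_sub.
  by rewrite lef_pV2 ?posrE ?exprn_gt0// ler_weXn2l// ler1n.
have := measure_bigcap_approx P (fun i => measurable_thickening _ _) niF e0.
rewrite (_ : \bigcap_i _ = C)//.
apply/seteqP; split => [x Tx|x Cx n _]; last first.
  by exists x => //; rewrite mdistxx invr_gt0 exprn_gt0.
apply: cC => B /nbhs_ballP[d /= d0 xdB].
have [n nd] : exists n, 2 ^- n < d.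
  have := @near_infty_natSinv_expn_lt R (PosNum d0).
  by move=> [N _ /(_ N (leqnn N))] /= H; exists N; rewrite -div1r.
have [y Cy xy] := Tx n I; exists y; split => //; apply: xdB.
by rewrite ballEmdist /=; exact: lt_trans nd.
Qed.

End prokhorov.

Section regularity.
Context {R : realType} (X : constructiveMetricType R).
Implicit Types (P Q : prob X) (x y z : X) (A B : set (borel X)).

Definition regular P (V : set X) := forall e : R, 0 < e ->
  exists C W : set X, [/\ closed C, open W, C `<=` V, V `<=` W &
    (P (W `\` C : set (borel X)) <= e%:E)%E].

Lemma open_regular P (V : set X) : open V -> regular P V.
Proof.
move=> oV e e0; have cV : closed (~` V) by exact: open_closedC.
have mcV := closed_measurable_borel cV.
have [M /(_ M (leqnn M))] := thickening_approx P cV e0.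
set T : set X := thickening _ _ => PT.
have oT : open T by exact: open_thickening.
have mT := open_measurable_borel oT.
have VT : ~` V `<=` T.
  by move=> x Vx; exists x => //; rewrite mdistxx invr_gt0 exprn_gt0.
exists (~` T), V; split => //; first exact: open_closedC.
  by move=> x Tx; apply: contrapT => /VT.
have -> : V `\` ~` T = T `\` ~` V.
  by rewrite setDE setCK setDE setCK setIC.
rewrite measureD//; last by rewrite (le_lt_trans (probability_le1 _ _))// ltry.
rewrite setIidr//.
by rewrite leeBlDr ?fin_num_measure// addeC ltW.
Qed.

Lemma regular_setC P (V : set X) : regular P V -> regular P (~` V).
Proof.
move=> rV e /rV[C [W [cC opO CV VsO PO]]]; exists (~` W), (~` C); split.
- exact: open_closedC.
- exact: closed_openC.
- exact: subsetC.
- exact: subsetC.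
- by rewrite setDE setCK setIC -setDE.
Qed.

Lemma regular_bigcup P (V : nat -> set X) : (forall i, regular P (V i)) ->
  regular P (\bigcup_i V i).
Proof.
move=> rV e e0.
have e20 : 0 < e / 2 by rewrite divr_gt0.
have ei i : 0 < e / 2 / (2 ^ i.+1)%:R by rewrite divr_gt0// ltr0n expn_gt0.
have /choice[CO COP] i : exists CO : set X * set X, [/\ closed CO.1, open CO.2,
    CO.1 `<=` V i, V i `<=` CO.2 &
    (P (CO.2 `\` CO.1 : set (borel X)) <= (e / 2 / (2 ^ i.+1)%:R)%:E)%E].
  by have [C [W COP]] := rV i _ (ei i); exists (C, W).
pose C i : set (borel X) := (CO i).1; pose W i : set (borel X) := (CO i).2.
have mC i : measurable (C i).
  by apply: closed_measurable_borel; have [] := COP i.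
have mO i : measurable (W i).
  by apply: open_measurable_borel; have [] := COP i.
have [N PN] := measure_bigcup_approx P mC e20.
exists (\bigcup_(i < N) C i), (\bigcup_i W i); split.
- rewrite bigcup_mkord; apply: closed_bigsetU => i _; by have [] := COP i.
- by apply: bigcup_open => i _; have [] := COP i.
- by move=> x [i _ Cx]; exists i => //; have [_ _ CV _ _] := COP i; exact: CV.
- by move=> x [i _ Vx]; exists i => //; have [_ _ _ VsO _] := COP i; exact: VsO.
have mCN : measurable (\bigcup_(i < N) C i) by exact: bigcup_measurable.
have mCU : measurable (\bigcup_i C i) by exact: bigcup_measurable.
have mOC : measurable (\bigcup_i (W i `\` C i)).
  by apply: bigcup_measurable => i _; exact: measurableD.
have sub : \bigcup_i W i `\` \bigcup_(i < N) C i `<=`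
    \bigcup_i (W i `\` C i) `|` (\bigcup_i C i `\` \bigcup_(i < N) C i).
  move=> x [[i _ Ox] NC]; have [Cx|Cx] := pselect (C i x).
    by right; split => //; exists i.
  by left; exists i.
have mO' : measurable (\bigcup_i W i) by exact: bigcup_measurable.
apply: (@le_trans _ _ (P (\bigcup_i (W i `\` C i) `|`
    (\bigcup_i C i `\` \bigcup_(i < N) C i)))).
  rewrite le_measure ?inE//; first exact: measurableD.
  by apply: measurableU => //; exact: measurableD.
apply: le_trans (measureU2 _ _ _) _ => //; first exact: measurableD.
rewrite (splitr e) EFinD; apply: leeD.
- apply: le_trans (generalized_Boole_inequality _ _ _) _ => //.
    by move=> i; exact: measurableD.
  apply: (@le_trans _ _ (\sum_(i <oo) (e / 2 / (2 ^ i.+1)%:R)%:E)%E).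
    by apply: lee_nneseries => // i _; have [] := COP i.
  exact/epsilon_trick0/ltW.
- rewrite measureD//; last by rewrite (le_lt_trans (probability_le1 _ _))// ltry.
  rewrite setIidr//; last by move=> x [i _ Cx]; exists i.
  by rewrite leeBlDr ?fin_num_measure// addeC ltW.
Qed.

Lemma measurable_regular P (V : set (borel X)) : measurable V -> regular P V.
Proof.
apply: smallest_sub; last by move=> U; exact: open_regular.
split; first exact/open_regular/open0.
- by move=> U rU; rewrite setTD; exact: regular_setC.
- by move=> F rF; exact: regular_bigcup.
Qed.

Lemma closed_inner_approx P (V : set (borel X)) (e : R) : measurable V -> 0 < e ->
  exists C : set X, [/\ closed C, C `<=` V & (P V <= P (C : set (borel X)) + e%:E)%E].
Proof.
move=> mV e0; have [C [W [cC opO CV VsO PO]]] := measurable_regular P mV e0.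
exists C; split => //.
have mC := closed_measurable_borel cC; have mO := open_measurable_borel opO.
apply: (@le_trans _ _ (P (C `|` (W `\` C) : set (borel X)))).
  rewrite le_measure ?inE//; first by apply: measurableU => //; exact: measurableD.
  by move=> x /VsO Wx; have [|] := pselect (C x); [left|right].
apply: le_trans (measureU2 _ _ _) _ => //; first exact: measurableD.
exact: leeD.
Qed.
End regularity.

Section density.
Context {R : realType} (X : constructiveMetricType R).
Implicit Types (P Q : prob X) (x y z : X) (A B : set (borel X)).

Definition mass n := (\sum_(i < size (CodeSeq.decode n)) nth 0 (CodeSeq.decode n) i)%N.

Lemma prokhorov_le P Q (e : R) : 0 < e ->
  (forall A, measurable A -> (P A <= Q (thickening e A) + e%:E)%E) ->
  prokhorov P Q <= e.
Proof.
move=> e0 PQe; rewrite /prokhorov; apply: ge_inf => //.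
by exists 0 => d [/ltW].
Qed.

Lemma ideal_prob_dense P (e : R) : 0 < e ->
  exists n, (0 < mass n)%N /\ prokhorov (ideal_prob X n) P < e.
Proof.
wlog e1 : e / e <= 1.
  move=> H e0; have [e1|/ltW e1] := leP e 1; first exact: H.
  have [n [Wn ne]] := H 1 (lexx _) ltr01; exists n; split => //.
  exact: lt_le_trans ne e1.
move=> e0; pose d := e / 8; have d0 : 0 < d by rewrite divr_gt0.
pose B i : set (borel X) := [set x : X | mdist (ideal i : X) x < d].
have mB i : measurable (B i) by apply: open_measurable_borel; exact: open_mdist_ball.
have [N] := measure_bigcup_approx P mB d0.
have -> : \bigcup_i B i = setT.
  by rewrite -subTset => x _; have [i ix] := ideal_approx x d0; exists i.
rewrite probability_setT bigcup_mkord bigsetU_seqDU => PN.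
pose D := seqDU B.
have mD i : measurable (D i).
  by apply: measurableD => //; exact: bigsetU_measurable.
pose p i := fine (P (D i)).
have pE i : P (D i) = (p i)%:E by rewrite fineK// fin_num_measure.
have p0 i : 0 <= p i by rewrite -lee_fin -pE.
have PS (b : nat -> bool) : P (\big[setU/set0]_(i < N) (if b i then D i else set0))
    = (\sum_(i < N) (if b i then p i else 0))%:E.
  rewrite measure_semi_additive_ord.
  - rewrite -sumEFin; apply: eq_bigr => i _; case: (b i); rewrite /= ?pE ?measure0 //.
  - by move=> k; case: (b k).
  - apply/trivIsetP => i j _ _ ij; case: (b i); rewrite ?set0I//.
    case: (b j); rewrite ?setI0//.
    by have /trivIsetP := trivIset_seqDU B; apply.
  - by apply: bigsetU_measurable => i _; case: (b i).
have {PN} pN : 1 < \sum_(i < N) p i + d.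
  by have := PS xpredT; rewrite /= => PE; move: PN; rewrite -/D PE -EFinD lte_fin.
pose M := (Num.truncn (N.+1%:R / d)).+1.
have NM : N.+1%:R <= M%:R * d.
  by rewrite -ler_pdivrMr// ltW// truncnS_gt.
have M0 : (0 : R) < M%:R by rewrite ltr0n.
pose w i := Num.truncn (M%:R * p i).
have wle i : (w i)%:R <= M%:R * p i by rewrite truncn_le mulr_ge0// ltW.
have wgt i : M%:R * p i <= (w i)%:R + 1 by rewrite ltW// natr1 truncnS_gt.
pose n := CodeSeq.code (mkseq w N).
have dn : CodeSeq.decode n = mkseq w N by exact: CodeSeq.codeK.
have massE : (mass n)%:R = \sum_(i < N) (w i)%:R :> R.
  rewrite /mass dn size_mkseq natr_sum; apply: eq_bigr => i _.
  by rewrite nth_mkseq.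
have Wgt : M%:R * (1 - 2 * d) <= (mass n)%:R :> R.
  have : M%:R * \sum_(i < N) p i <= (mass n)%:R + N%:R.
    have -> : N%:R = \sum_(i < N) 1 :> R by rewrite sumr_const card_ord.
    rewrite mulr_sumr massE -big_split/=.
    by apply: ler_sum => i _; exact: wgt.
  have : (N%:R : R) <= N.+1%:R by rewrite ler_nat.
  nra.
have W0 : 0 < (mass n)%:R :> R.
  by apply: lt_le_trans Wgt; rewrite mulr_gt0// /d; lra.
have Wlt : M%:R - (mass n)%:R <= (mass n)%:R * (e / 2).
  have e20 : 0 <= 1 + e / 2 by lra.
  have := ler_wpM2r e20 Wgt; rewrite /d.
  have : 0 <= M%:R * (e * (2 - e)) by rewrite !mulr_ge0 ?(ltW M0) ?(ltW e0)//; lra.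
  by lra.
exists n; split; first by rewrite -(ltr0n R).
suff : prokhorov (ideal_prob X n) P <= e / 2.
  by move/le_lt_trans; apply; lra.
apply: prokhorov_le; first by rewrite divr_gt0.
move=> A mA; have mT : measurable (thickening (e / 2) A : set (borel X)).
  exact: measurable_thickening.
have nE := @ideal_probE R X n A _; rewrite nE -/(mass n); last by rewrite -(ltr0n R).
set t := fine (P (thickening (e / 2) A)).
have tE : P (thickening (e / 2) A) = t%:E by rewrite fineK// fin_num_measure.
have t1 : t <= 1 by rewrite -lee_fin -tE probability_le1.
have t0 : 0 <= t by rewrite -lee_fin -tE.
rewrite tE -EFinD lee_fin ler_pdivrMr//.
have : \sum_(i < size (CodeSeq.decode n)) (nth 0 (CodeSeq.decode n) i)%:R *
    \1_A (ideal i : borel X) <= M%:R * t.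
  have : \sum_(i < N) (if (ideal i : borel X) \in A then p i else 0) <= t.
    rewrite -lee_fin -tE -(PS (fun i => (ideal i : borel X) \in A)).
    rewrite le_measure ?inE//.
      by apply: bigsetU_measurable => i _; case: ifP.
    rewrite -(bigcup_mkord N (fun i =>
      if (ideal i : borel X) \in A then D i else set0)) => x [i _].
    case: ifPn => // /set_mem Ai Dx.
    exists (ideal i) => //; have : B i x by exact: subset_seqDU Dx.
    by rewrite /B /= metric_sym => /lt_trans; apply; rewrite /d; lra.
  rewrite -(ler_pM2l M0); apply: le_trans.
  rewrite dn size_mkseq mulr_sumr; apply: ler_sum => i _.
  rewrite nth_mkseq// indicE; case: (_ \in A); rewrite ?mulr1 ?mulr0//.
have := ler_wpM2r t0 Wlt.
have : 0 <= (mass n)%:R * (e * (1 - t)).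
  by rewrite !mulr_ge0 ?(ltW W0) ?(ltW e0)// subr_ge0.
lra.
Qed.
End density.

(** * Uniform tests *)

(* Decides [rat_num q < a / 2 ^ m]. *)
Definition rat_lt (q a m : nat) : bool :=
  let s := CodeSeq.decode q in
  (nth 0 s 0 * 2 ^ m < a * (nth 0 s 2).+1 + nth 0 s 1 * 2 ^ m)%N.

Lemma rcb_rat_lt k Q A M : rc k Q -> rc k A -> rc k M ->
  rcb k (fun s => rat_lt (Q s) (A s) (M s)).
Proof.
move=> rQ rA rM; have rn i : rc k (fun s => nth 0 (CodeSeq.decode (Q s)) i).
  by apply: rc_nth => //; exact: rc_const.
apply: (rcb_leq (F := fun s => (_ * 2 ^ M s).+1)%N).
  by apply: rc_succ; apply: rc_mul => //; exact: rc_exp.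
apply: rc_add; apply: rc_mul => //; [exact: rc_succ|exact: rc_exp].
Qed.

Lemma rat_ltE (R : realType) q a m :
  (ratr (rat_num q) < a%:R / 2 ^+ m :> R) = rat_lt q a m.
Proof.
rewrite /rat_num /rat_lt; set s := CodeSeq.decode q.
rewrite rmorph_div/= ?unitfE ?pnatr_eq0// rmorphB/= !ratr_nat.
rewrite ltr_pdivrMr ?ltr0n// mulrAC ltr_pdivlMr ?exprn_gt0//.
rewrite mulrBl ltrBlDr -natrX -!natrM -natrD ltr_nat.
by rewrite mulnC.
Qed.

Lemma rat_num_surj (q : rat) : exists n, rat_num n = q.
Proof.
have [a [b qE]] : exists a b : nat, numq q = a%:Z - b%:Z.
  by case: (numq q) => n; [exists n, 0%N|exists 0%N, n.+1]; rewrite ?subr0 ?sub0r.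
have [c cE] : exists c : nat, denq q = c.+1%:Z.
  by case: (denq q) (denq_gt0 q) => [[//|c]|//] _; exists c.
exists (CodeSeq.code [:: a; b; c]); rewrite /rat_num CodeSeq.codeK/=.
by rewrite -[RHS]divq_num_den qE cE rmorphB.
Qed.

Lemma rat_num_between (R : realType) (a b : R) : a < b ->
  exists q, a < ratr (rat_num q) < b.
Proof.
move=> /rat_in_itvoo[q]; rewrite in_itv/= => aqb.
by have [n nq] := rat_num_surj q; exists n; rewrite nq.
Qed.

Lemma rat_num_gt (R : realType) (a : R) : exists q, a < ratr (rat_num q).
Proof.
have [|q /andP[aq _]] := @rat_num_between R a (a + 1); first by rewrite ltrDl.
by exists q.
Qed.

Section measurability.
Context {R : realType} (X : constructiveMetricType R).
Implicit Types (P Q : prob X) (x y z : X) (A B : set (borel X)).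

Lemma measurable_lower_semicomputable (f : X -> prob X -> \bar R) P :
  lower_semicomputable f -> measurable_fun (setT : set (borel X)) (f ^~ P).
Proof.
move=> [_ [E [_ EP]]].
have op r : open [set x : X | ((ratr (rat_num r))%:E < f x P)%E].
  rewrite (_ : [set x | _] = \bigcup_(v in [set v : nat * nat |
      exists j s, E [tuple r; v.1; v.2; j; s] /\
        basic_ball (@prokhorov R X) (ideal_prob X) j s P])
      [set x : X | mdist (ideal v.1 : X) x < ratr (rat_num v.2)]).
    by apply: bigcup_open => v _; exact: open_mdist_ball.
  apply/seteqP; split => [x /= /EP[i [q [j [s [Ev xB PB]]]]]|].
    by exists (i, q) => //=; exists j, s.
  by move=> x [[i q] /= [j [s [Ev PB]]] xB]; apply/EP; exists i, q, j, s.
apply: (measurability _ (ErealGenOInfty.measurableE R)) => // _ [_ [a ->] <-].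
rewrite setTI (_ : _ @^-1` _ = \bigcup_(r in [set r | a <= ratr (rat_num r)])
    [set x : X | ((ratr (rat_num r))%:E < f x P)%E]); last first.
  apply/seteqP; split => [x|x [r /= ar]]; rewrite /= in_itv/= andbT; last first.
    by apply: le_lt_trans; rewrite lee_fin.
  move=> af; suff [r /andP[ar rf]] : exists r, (a%:E < (ratr (rat_num r))%:E < f x P)%E.
    by exists r => //=; rewrite ltW -?lte_fin.
  case: (f x P) af => [b| |//]; rewrite ?lte_fin.
    move=> /rat_num_between[r]; by exists r; rewrite !lte_fin.
  move=> _; have [r ar] := rat_num_gt a.
  by exists r; rewrite lte_fin ar ltry.
apply: bigcup_measurable => r _; exact: open_measurable_borel.
Qed.

Lemma uniform_test_ae (f : X -> prob X -> \bar R) P : uniform_test f ->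
  measurable ([set x | f x P = +oo%E] : set (borel X)) /\
  P ([set x | f x P = +oo%E] : set (borel X)) = 0%E.
Proof.
move=> [lf /(_ P) fP]; have mf := measurable_lower_semicomputable P lf.
have f0 : forall x, (0 <= f x P)%E by have [f0 _] := lf.
have mi : measurable ([set x | f x P = +oo%E] : set (borel X)).
  rewrite (_ : [set x | _] = setT `&` ((f ^~ P) @^-1` [set +oo%E])); last first.
    by rewrite setTI.
  by apply: mf => //; exact: emeasurable_set1.
split => //; apply: measure_negligible => //.
have /integrable_ae -/(_ measurableT)[] : P.-integrable setT (f ^~ P : borel X -> \bar R).
  apply/integrableP; split => //; apply: le_lt_trans (ltry 1).
  rewrite (_ : (fun x : borel X => `|f x P|%E) = f ^~ P)//.
  by apply/funext => x; rewrite gee0_abs.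
move=> N [mN N0 subN]; exists N; split => // x /= fx; apply: subN => /=.
by rewrite fx => /(_ I).
Qed.
End measurability.

Section tests.
Context {R : realType} (X : constructiveMetricType R).
Implicit Types (P Q : prob X) (x y z : X) (A B : set (borel X)).

Section sequence_test.
Variables (A : nat -> nat -> bool) (m j s : nat -> nat).
Hypothesis rA : rcb 2 (fun v => A (nth 0%N v 0) (nth 0%N v 1)).
Hypothesis rm : rc 1 (fun v => m (nth 0%N v 0)).
Hypothesis rj : rc 1 (fun v => j (nth 0%N v 0)).
Hypothesis rs : rc 1 (fun v => s (nth 0%N v 0)).

Definition ball_union n : set X :=
  \bigcup_(i in [set i | A n i]) [set x : X | mdist (ideal i : X) x < 2 ^- m n].

(* The supremum, unlike the sum, is [> r] as soon as a single term is, so lower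
   semicomputability needs no intersections of basic balls. *)
Definition sequence_test x P : \bar R := ereal_sup [set z | z = 0%E \/
  exists n, [/\ ball_union n x, basic_ball (@prokhorov R X) (ideal_prob X) (j n) (s n) P &
    z = (n%:R)%:E]].

Lemma sequence_test_ge0 x P : (0 <= sequence_test x P)%E.
Proof. by apply: ereal_sup_ubound; left. Qed.

Lemma open_ball_union n : open (ball_union n).
Proof. by apply: bigcup_open => i _; exact: open_mdist_ball. Qed.

Lemma sequence_test_lower_semicomputable : lower_semicomputable sequence_test.
Proof.
split; first exact: sequence_test_ge0.
pose B v := rat_lt (nth 0%N v 1) 0 0 || [&& A (nth 0%N v 0) (nth 0%N v 2),
  rat_lt (nth 0%N v 3) 1 (m (nth 0%N v 0)), nth 0%N v 4 == j (nth 0%N v 0),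
  nth 0%N v 5 == s (nth 0%N v 0) & rat_lt (nth 0%N v 1) (nth 0%N v 0) 0].
have rB : rcb 6 B.
  have v0 : rc 6 (nth 0%N ^~ 0%N) by exact: rc_var.
  have v1 : rc 6 (nth 0%N ^~ 1%N) by exact: rc_var.
  have r0 := rc_const 6 0.
  apply: rcb_or; first exact: rcb_rat_lt.
  apply: rcb_and; first by apply: (rc_comp2 rA v0); exact: rc_var.
  apply: rcb_and.
    by apply: rcb_rat_lt; [exact: rc_var|exact: rc_const|exact: (rc_comp1 rm v0)].
  apply: rcb_and; first by apply: rcb_eq; [exact: rc_var|exact: (rc_comp1 rj v0)].
  apply: rcb_and; first by apply: rcb_eq; [exact: rc_var|exact: (rc_comp1 rs v0)].
  exact: rcb_rat_lt.
exists [set v : 5.-tuple nat | exists n, B (n :: v)]; split.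
  exact: enumerable_rc.
move=> r x P; split.
- move=> /ereal_sup_gt[z [->|[n [[i Ai xi] Pn ->]]]]; rewrite lte_fin => rz.
  + have [q xq] := rat_num_gt (mdist (ideal 0 : X) x).
    have [q2 Pq] := rat_num_gt (prokhorov (ideal_prob X 0) P).
    by exists 0%N, q, 0%N, q2; split => //; exists 0%N; rewrite /B/= -(rat_ltE R) mul0r rz.
  + have [q /andP[xq qm]] := rat_num_between xi.
    exists i, q, (j n), (s n); split => //; exists n.
    rewrite /B/= Ai !eqxx -(rat_ltE R q 1) div1r qm/= -(rat_ltE R r n 0).
    by rewrite expr0 divr1 rz orbT.
- move=> [i [q [j' [s' [[n] ]]]]]; rewrite /B/= => /orP[|].
    rewrite -(rat_ltE R) mul0r => r0 _ _.
    by apply: lt_le_trans (sequence_test_ge0 _ _); rewrite lte_fin.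
  move=> /and5P[Ai]; rewrite -!(rat_ltE R) expr0 divr1 div1r => qm /eqP -> /eqP -> rn.
  move=> xi Pn; apply: (@lt_le_trans _ _ (n%:R)%:E); first by rewrite lte_fin.
  apply: ereal_sup_ubound; right; exists n; split => //.
  by exists i => //=; exact: lt_trans qm.
Qed.

Hypothesis Asmall : forall n P,
  basic_ball (@prokhorov R X) (ideal_prob X) (j n) (s n) P ->
  (P (ball_union n : set (borel X)) <= (2 ^- n.*2.+1)%:E)%E.

Lemma sequence_test_uniform : uniform_test sequence_test.
Proof.
split; first exact: sequence_test_lower_semicomputable.
move=> P; pose PB n := basic_ball (@prokhorov R X) (ideal_prob X) (j n) (s n) P.
pose U n : set (borel X) := if `[< PB n >] then ball_union n else set0.
have mU n : measurable (U n).
  by rewrite /U; case: asboolP => // _; apply: open_measurable_borel; exact: open_ball_union.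
pose g n (x : borel X) : \bar R := (n%:R%:E * (\1_(U n) x)%:E)%E.
have g0 n x : (0 <= g n x)%E by rewrite mule_ge0 ?lee_fin.
have mg n : measurable_fun [set: borel X] (g n).
  by apply: measurable_funeM; apply/measurable_EFinP; exact: measurable_indic.
apply: (@le_trans _ _ (\int[P]_(x in [set: borel X]) (\sum_(n <oo) g n x))%E).
  apply: ge0_le_integral => //.
  - by move=> x _; exact: sequence_test_ge0.
  - exact: measurable_lower_semicomputable sequence_test_lower_semicomputable.
  - by apply: ge0_emeasurable_sum => // n x _ _; exact: g0.
  move=> x _; apply: ge_ereal_sup => z [->|[n [Ux Pn ->]]].
    by apply: nneseries_ge0 => n _ _; exact: g0.
  apply: le_trans (nneseries_lim_ge n.+1 _); last by move=> k _ _; exact: g0.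
  rewrite big_nat_recr//= {2}/g /U asboolT// indicE mem_set// mule1 leeDr//.
  by apply: sume_ge0 => k _; exact: g0.
rewrite integral_nneseries//.
apply: le_trans (@epsilon_trick0 R 1 xpredT ler01).
apply: lee_nneseries => [n _ _|n _]; first by apply: integral_ge0 => x _; exact: g0.
rewrite ge0_integralZl_EFin//; last first.
  by apply/measurable_EFinP; exact: measurable_indic.
rewrite integral_indic// setIT.
apply: (@le_trans _ _ (n%:R%:E * (2 ^- n.*2.+1)%:E)%E).
  apply: lee_wpmul2l; first by rewrite lee_fin.
  rewrite /U; case: asboolP => [/Asmall//|_].
  by rewrite measure0 lee_fin invr_ge0 exprn_ge0.
rewrite -EFinM lee_fin ler_pdivrMr ?exprn_gt0// natrX div1r.
rewrite -addnn -addnS exprD mulrCA mulVf ?expf_neq0// mulr1 -natrX ler_nat.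
exact/ltnW/ltn_expl.
Qed.

Lemma sequence_test_infty t x P : universal_uniform_test t ->
  (forall n, basic_ball (@prokhorov R X) (ideal_prob X) (j n) (s n) P) ->
  (forall N, exists n, (N <= n)%N /\ ball_union n x) -> t x P = +oo%E.
Proof.
move=> [[[t0 _] _] /(_ _ sequence_test_uniform)[c c0 tc]] Pb Ux.
apply/eqP; rewrite -leye_eq leNgt; apply/negP => tfin.
have tf : t x P \is a fin_num.
  by rewrite ge0_fin_numE.
have := tc x P; rewrite -(fineK tf) -EFinM.
set b := c * _ => fb.
have [n [bn Un]] := Ux (Num.truncn b).+1.
have : ((n%:R)%:E <= b%:E)%E.
  by apply: le_trans fb; apply: ereal_sup_ubound; right; exists n.
rewrite lee_fin leNgt => /negP; apply.
by apply: lt_le_trans (truncnS_gt b) _; rewrite ler_nat.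
Qed.
End sequence_test.
End tests.

(** * Recursive search for separating sets *)

Local Notation entry z i := (nth 0%N (CodeSeq.decode z) i).

Lemma size_decode n : (size (CodeSeq.decode n) <= n)%N.
Proof.
elim/ltn_ind: n => -[//|n] IHn; have [h [t tn]] := @codeE n.+1 isT.
have tlt : (t < n.+1)%N by rewrite tn; have : (0 < 2 ^ h)%N; [rewrite expn_gt0|nia].
rewrite {1}tn decode_cons /=; exact: leq_ltn_trans (IHn t tlt) tlt.
Qed.

Lemma sum_decode (F : nat -> nat) n : (forall l, entry n l = 0 -> F l = 0)%N ->
  (\sum_(l < size (CodeSeq.decode n)) F l = \sum_(0 <= l < n) F l)%N.
Proof.
move=> F0; rewrite -(big_mkord xpredT)
  [RHS](@big_cat_nat _ _ _ (size (CodeSeq.decode n))) ?size_decode//=.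
rewrite [X in (_ + X)%N]big1_seq ?addn0// => l.
rewrite mem_index_iota => /andP[_ /andP[nl _]].
by apply: F0; rewrite nth_default.
Qed.

(* [ideal_prob X j] gives the indices satisfying [b] mass at most [2 ^- N]; the
   sums may run up to [j], a bound on the length of its decoding. *)
Definition light (b : nat -> bool) N j :=
  (0 < \sum_(0 <= l < j) entry j l)%N &&
  (2 ^ N * \sum_(0 <= l < j) entry j l * b l <= \sum_(0 <= l < j) entry j l)%N.

Lemma rcb_light k (b : nat -> nat -> bool) N J Z :
  rcb 2 (fun v => b (nth 0%N v 0) (nth 0%N v 1)) -> rc k N -> rc k J -> rc k Z ->
  rcb k (fun s => light (b ^~ (Z s)) (N s) (J s)).
Proof.
move=> rb rN rJ rZ.
have v0 : rc 4 (nth 0%N ^~ 0%N) by exact: rc_var.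
have v2 : rc 4 (nth 0%N ^~ 2%N) by exact: rc_var.
have v3 : rc 4 (nth 0%N ^~ 3%N) by exact: rc_var.
have w2 : rc 3 (nth 0%N ^~ 1%N) by exact: rc_var.
have rW : rc 3 (fun v => \sum_(0 <= l < nth 0%N v 1) entry (nth 0%N v 1) l)%N.
  apply: (rc_sum (F := fun s => entry (nth 0%N s 2) (nth 0%N s 0))) => //.
  exact: rc_nth.
suff rL : rcb 3 (fun v => light (b ^~ (nth 0%N v 2)) (nth 0%N v 0) (nth 0%N v 1)).
  exact: rc_comp3 rL rN rJ rZ.
apply: rcb_and; first exact: (rcb_leq (rc_succ (rc_const 3 0)) rW).
apply: (rcb_leq _ rW); apply: rc_mul; first by apply: rc_exp; exact: rc_var.
apply: (rc_sum (F := fun s => (entry (nth 0 s 2) (nth 0 s 0) *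
  b (nth 0 s 0) (nth 0 s 3))%N)) => //.
by apply: rc_mul; [exact: rc_nth|exact: rc_comp2 rb v0 v3].
Qed.

Section light_sets.
Context {R : realType} (X : constructiveMetricType R).
Implicit Types (P Q : prob X) (x y z : X).

Lemma ideal_prob_lightE j (A : set (borel X)) :
  (0 < \sum_(0 <= l < j) entry j l)%N ->
  ideal_prob X j A = ((\sum_(0 <= l < j) entry j l * ((ideal l : borel X) \in A))%N%:R
    / (\sum_(0 <= l < j) entry j l)%N%:R : R)%:E.
Proof.
move=> W0; have := @ideal_probE R X j A; cbv zeta; rewrite sum_decode// => ->//.
rewrite -(@sum_decode (fun l => entry j l * ((ideal l : borel X) \in A))%N); last first.
  by move=> l ->.
congr (_ / _)%:E; rewrite natr_sum; apply: eq_bigr => i _.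
by rewrite natrM indicE.
Qed.

Lemma light_ideal_prob (b : nat -> bool) N j (A : set (borel X)) : light b N j ->
  (forall l, A (ideal l) -> b l) -> (ideal_prob X j A <= (2 ^- N)%:E)%E.
Proof.
move=> /andP[W0 bN] Ab; rewrite ideal_prob_lightE// lee_fin.
rewrite ler_pdivrMr ?ltr0n// mulrC ler_pdivlMr ?exprn_gt0// -natrX -natrM ler_nat.
apply: leq_trans bN; rewrite mulnC leq_mul2l; apply/orP; right.
apply: leq_sum => l _; rewrite leq_mul2l; apply/orP; right.
by case: (boolP (_ \in A)) => // /set_mem/Ab ->.
Qed.

Lemma ideal_prob_light (b : nat -> bool) N j (A : set (borel X)) : (0 < mass j)%N ->
  (forall l, b l -> A (ideal l)) -> (ideal_prob X j A <= (2 ^- N)%:E)%E -> light b N j.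
Proof.
rewrite /mass sum_decode// => W0 bA; rewrite ideal_prob_lightE// lee_fin.
rewrite ler_pdivrMr ?ltr0n// mulrC ler_pdivlMr ?exprn_gt0// -natrX -natrM ler_nat => jN.
rewrite /light W0 /=; apply: leq_trans jN.
rewrite mulnC leq_mul2r; apply/orP; right.
apply: leq_sum => l _; rewrite leq_mul2l; apply/orP; right.
by case: (boolP (b l)) => // /bA/mem_set ->.
Qed.

Lemma computable_prob_enum P : computable_prob P -> exists j s : nat -> nat,
  [/\ rc 1 (fun v => j (nth 0%N v 0)), rc 1 (fun v => s (nth 0%N v 0)),
    forall u, basic_ball (@prokhorov R X) (ideal_prob X) (j u) (s u) P &
    forall a q, basic_ball (@prokhorov R X) (ideal_prob X) a q P ->
      exists u, j u = a /\ s u = q].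
Proof.
move=> [E0|[f [rf /seteqP[Esub Esup]]]].
  have [a [_ aP]] := ideal_prob_dense P (@ltr01 R).
  have [q /andP[q1 _]] := rat_num_between aP.
  by move/seteqP: E0 => [/(_ [tuple a; q])] /(_ q1).
have tE (v : 1.-tuple nat) : v = [tuple nth 0%N v 0].
  by apply/eq_from_tnth => i; rewrite ord1 !(tnth_nth 0%N).
have rcf i : rc 1 (fun v => f i [tuple nth 0%N v 0]).
  by apply: recursive_rc (rf i) => v; rewrite -tE.
exists (fun u => f ord0 [tuple u]), (fun u => f ord_max [tuple u]); split => //.
- move=> u; have := Esup [tuple f i [tuple u] | i < 2] (ex_intro2 _ _ u I erefl).
  by rewrite /= !tnth_mktuple.
- move=> a q aqP; have [u _ uaq] := Esub [tuple a; q] aqP; exists u.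
  by rewrite -!(tnth_mktuple (fun i => f i [tuple u])) uaq.
Qed.

Lemma mdist_ideal_approx : exists dd : nat -> nat -> nat -> nat,
  rc 3 (fun v => dd (nth 0%N v 0) (nth 0%N v 1) (nth 0%N v 2)) /\
  forall p a b, `|mdist (ideal a : X) (ideal b) - ratr (rat_num (dd p a b))| <= 2 ^- p :> R.
Proof.
have [f [rf fE]] := @ideal_computable R X.
exists (fun p a b => f [tuple p; a; b]); split.
  apply: recursive_rc rf => v; congr f; apply/eq_from_tnth => i.
  rewrite !(tnth_nth 0%N); by case: i => [[|[|[]]]].
move=> p a b; have := fE p [tuple a; b]; congr (`|_ - ratr (rat_num (f _))| <= _).
Qed.

End light_sets.

Section search.
Context {R : realType} (X : constructiveMetricType R).
Implicit Types (P Q : prob X) (x y : X).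
Variable dd : nat -> nat -> nat -> nat.
Hypothesis rdd : rc 3 (fun v => dd (nth 0%N v 0) (nth 0%N v 1) (nth 0%N v 2)).
Hypothesis ddE : forall p a b,
  `|mdist (ideal a : X) (ideal b) - ratr (rat_num (dd p a b))| <= 2 ^- p :> R.

(* [dd m a c] approximates the distance of the ideal points [a] and [c] up to
   [2 ^- m], so [close_to th] decides whether [a] is within [th * 2 ^- m] of some
   centre with a tolerance of one unit of [2 ^- m]. *)
Definition close_to th a z :=
  has (fun i => rat_lt (dd (entry z 2) a (entry z (4 + i))) th (entry z 2))
    (iota 0 (entry z 3)).

Lemma rcb_close_to th : rcb 2 (fun v => close_to th (nth 0%N v 0) (nth 0%N v 1)).
Proof.
have v0 : rc 3 (nth 0%N ^~ 0%N) by exact: rc_var.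
have v1 : rc 3 (nth 0%N ^~ 1%N) by exact: rc_var.
have v2 : rc 3 (nth 0%N ^~ 2%N) by exact: rc_var.
have rz : rc 3 (fun s => entry (nth 0%N s 2) 2) by apply: rc_nth => //; exact: rc_const.
apply: (rcb_has (B := fun s => rat_lt (dd (entry (nth 0%N s 2) 2) (nth 0%N s 1)
    (entry (nth 0%N s 2) (4 + nth 0%N s 0))) th (entry (nth 0%N s 2) 2))).
  by apply: rc_nth; [exact: rc_var|exact: rc_const].
apply: rcb_rat_lt => //; last exact: rc_const.
by apply: (rc_comp3 rdd) => //; apply: rc_nth => //; apply: rc_add => //; exact: rc_const.
Qed.

Lemma close_to_mdist th a z : close_to th a z -> exists2 i, (i < entry z 3)%N &
  mdist (ideal a : X) (ideal (entry z (4 + i))) < th.+1%:R * 2 ^- entry z 2 :> R.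
Proof.
move=> /hasP[i]; rewrite mem_iota /= add0n => iK; rewrite -(rat_ltE R) => lt.
exists i => //; have := ddE (entry z 2) a (entry z (4 + i)).
rewrite ler_norml => /andP[_]; rewrite -(natr1 th) mulrDl mul1r; move: lt.
by set e := 2 ^- _; lra.
Qed.

Lemma mdist_close_to th a z i : (i < entry z 3)%N ->
  mdist (ideal a : X) (ideal (entry z (4 + i))) < th%:R * 2 ^- entry z 2 :> R ->
  close_to th.+1 a z.
Proof.
move=> iK lt; apply/hasP; exists i; first by rewrite mem_iota.
rewrite -(rat_ltE R); have := ddE (entry z 2) a (entry z (4 + i)).
rewrite ler_norml => /andP[+ _]; rewrite -(natr1 th) mulrDl mul1r; move: lt.
by set e := 2 ^- _; lra.
Qed.

Variables (jP sP jQ sQ : nat -> nat).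

(* [z] codes [:: u; v; m; K; c_0; ...; c_(K-1)]: [u] and [v] index the
   enumerated balls around [P] and [Q], the [c_i] are the centres. *)
Definition good n z := [&& rat_lt (sP (entry z 0)) 1 (entry z 2).+1,
  rat_lt (sQ (entry z 1)) 1 (entry z 2).+1, (n.*2.+2 <= entry z 2)%N,
  light (close_to 10 ^~ z) n.*2.+2 (jP (entry z 0)) &
  light (fun l => ~~ close_to 2 l z) n.*2.+2 (jQ (entry z 1))].

Lemma rcb_good : rc 1 (fun v => jP (nth 0%N v 0)) -> rc 1 (fun v => sP (nth 0%N v 0)) ->
  rc 1 (fun v => jQ (nth 0%N v 0)) -> rc 1 (fun v => sQ (nth 0%N v 0)) ->
  rcb 2 (fun v => good (nth 0%N v 0) (nth 0%N v 1)).
Proof.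
move=> rjP rsP rjQ rsQ.
have v0 : rc 2 (nth 0%N ^~ 0%N) by exact: rc_var.
have v1 : rc 2 (nth 0%N ^~ 1%N) by exact: rc_var.
have rz i : rc 2 (fun s => entry (nth 0%N s 1) i) by apply: rc_nth => //; exact: rc_const.
have rn : rc 2 (fun s => (nth 0%N s 0).*2.+2).
  apply: rc_ext (rc_succ (rc_succ (rc_add v0 v0))) => s _.
  by rewrite addnn.
have c1 := rc_const 2 1.
have t1 := rcb_rat_lt (rc_comp1 rsP (rz 0%N)) c1 (rc_succ (rz 2%N)).
have t2 := rcb_rat_lt (rc_comp1 rsQ (rz 1%N)) c1 (rc_succ (rz 2%N)).
have t3 := rcb_leq rn (rz 2%N).
have t4 := rcb_light (rcb_close_to 10) rn (rc_comp1 rjP (rz 0%N)) v1.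
have t5 := rcb_light (b := fun l z => ~~ close_to 2 l z)
  (rcb_not (rcb_close_to 2)) rn (rc_comp1 rjQ (rz 1%N)) v1.
exact: rcb_and t1 (rcb_and t2 (rcb_and t3 (rcb_and t4 t5))).
Qed.

Lemma light_measure (b : nat -> bool) N j q m P (G : set X) :
  light b N.+1 j -> rat_lt q 1 m.+1 -> (N <= m)%N -> open G ->
  (forall l x, G x -> mdist (ideal l : X) x < 2 ^- m.+1 -> b l) ->
  basic_ball (@prokhorov R X) (ideal_prob X) j q P ->
  (P (G : set (borel X)) <= (2 ^- N)%:E)%E.
Proof.
rewrite -(rat_ltE R) div1r => bj qm Nm oG Gb jP'.
have mG := open_measurable_borel oG.
apply: le_trans (prokhorov_lt_sym jP' mG) _.
rewrite (_ : 2 ^- N = 2 ^- N.+1 + 2 ^- N.+1 :> R); last first.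
  by rewrite -[RHS]mulr2n -[RHS]mulr_natl exprS invfM mulVKf.
rewrite EFinD; apply: leeD.
  apply: light_ideal_prob bj _ => l [x Gx lx]; apply: Gb Gx _.
  exact: lt_trans qm.
rewrite lee_fin; apply: le_trans (ltW qm) _.
by rewrite lef_pV2 ?posrE ?exprn_gt0// ler_weXn2l ?ler1n.
Qed.

Definition balls_in z : set X := \bigcup_(a in [set a | close_to 6 a z])
  [set x : X | mdist (ideal a : X) x < 2 ^- entry z 2].
Definition balls_out z : set X := \bigcup_(a in [set a | ~~ close_to 6 a z])
  [set x : X | mdist (ideal a : X) x < 2 ^- entry z 2].

Lemma exp2NS n : 2 ^- n = 2 * 2 ^- n.+1 :> R.
Proof. by rewrite exprS invfM mulVKf. Qed.

Lemma balls_in_small n z P : good n z ->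
  basic_ball (@prokhorov R X) (ideal_prob X) (jP (entry z 0)) (sP (entry z 0)) P ->
  (P (balls_in z : set (borel X)) <= (2 ^- n.*2.+1)%:E)%E.
Proof.
move=> /and5P[sPz _ nz lz _]; apply: light_measure lz sPz (ltnW nz) _ _.
  by apply: bigcup_open => a _; exact: open_mdist_ball.
move=> l x [a /= /close_to_mdist[i iK ai] ax] lx.
apply: (mdist_close_to iK).
have := metric_triangle (ideal l : X) x (ideal (entry z (4 + i))).
have := metric_triangle x (ideal a : X) (ideal (entry z (4 + i))).
rewrite (metric_sym x (ideal a)); move: ai ax lx; rewrite exp2NS.
have : 0 < 2 ^- (entry z 2).+1 :> R by rewrite invr_gt0 exprn_gt0.
by set e := 2 ^- _; lra.
Qed.

Lemma balls_out_small n z P : good n z ->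
  basic_ball (@prokhorov R X) (ideal_prob X) (jQ (entry z 1)) (sQ (entry z 1)) P ->
  (P (balls_out z : set (borel X)) <= (2 ^- n.*2.+1)%:E)%E.
Proof.
move=> /and5P[_ sQz nz _ lz]; apply: light_measure lz sQz (ltnW nz) _ _.
  by apply: bigcup_open => a _; exact: open_mdist_ball.
move=> l x [a /= na ax] lx.
apply/negP => /close_to_mdist[i iK li]; move/negP: na; apply.
apply: (mdist_close_to iK).
have := metric_triangle (ideal a : X) x (ideal (entry z (4 + i))).
have := metric_triangle x (ideal l : X) (ideal (entry z (4 + i))).
rewrite (metric_sym x (ideal l)); move: li ax lx; rewrite exp2NS.
have : 0 < 2 ^- (entry z 2).+1 :> R by rewrite invr_gt0 exprn_gt0.
by set e := 2 ^- _; lra.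
Qed.

Lemma balls_in_out z x : balls_in z x \/ balls_out z x.
Proof.
have [|a ax] := @ideal_approx R X x (2 ^- entry z 2).
  by rewrite invr_gt0 exprn_gt0.
by case: (boolP (close_to 6 a z)) => az; [left|right]; exists a.
Qed.

Lemma small_ball_exists (jj ss : nat -> nat) P m :
  (forall a q, basic_ball (@prokhorov R X) (ideal_prob X) a q P ->
      exists u, jj u = a /\ ss u = q) ->
  exists u, [/\ rat_lt (ss u) 1 m, (0 < mass (jj u))%N &
    basic_ball (@prokhorov R X) (ideal_prob X) (jj u) (ss u) P].
Proof.
move=> surj; have m0 : 0 < 2 ^- m :> R by rewrite invr_gt0 exprn_gt0.
have [a [a0 aP]] := ideal_prob_dense P m0.
have [q /andP[aq qm]] := rat_num_between aP.
have [u [ua uq]] := surj a q aq; exists u; rewrite ua uq; split => //.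
by rewrite -(rat_ltE R) div1r.
Qed.

Variables (P Q : prob X).
Hypothesis surjP : forall a q, basic_ball (@prokhorov R X) (ideal_prob X) a q P ->
  exists u, jP u = a /\ sP u = q.
Hypothesis surjQ : forall a q, basic_ball (@prokhorov R X) (ideal_prob X) a q Q ->
  exists u, jQ u = a /\ sQ u = q.

Lemma good_exists (V : set (borel X)) n : measurable V -> P V = 0%E -> Q V = 1%E ->
  exists z, good n z.
Proof.
move=> mV PV QV; pose N := n.*2.+2; pose e : R := 2 ^- N.+1.
have e0 : 0 < e by rewrite invr_gt0 exprn_gt0.
have e20 : 0 < e / 2 by rewrite divr_gt0.
have [C [cC CV QC]] := closed_inner_approx Q mV e20.
have mC := closed_measurable_borel cC.
have PC : P (C : set (borel X)) = 0%E.
  by apply/eqP; rewrite eq_le measure_ge0 andbT -PV le_measure ?inE.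
have [M PM] := thickening_approx P cC e0.
pose m := (N + M + 4)%N; pose h : R := 2 ^- m.
have h0 : 0 < h by rewrite invr_gt0 exprn_gt0.
have h20 : 0 < h / 2 by rewrite divr_gt0.
pose T := thickening (h / 2) C.
pose B i : set (borel X) := [set x : X | mdist (ideal i : X) x < h / 2].
pose F i : set (borel X) := if `[< T (ideal i) >] then B i else set0.
have mF i : measurable (F i).
  by rewrite /F; case: asboolP => // _; apply: open_measurable_borel; exact: open_mdist_ball.
have [K QK] := measure_bigcup_approx Q mF e20.
pose c := [seq i <- iota 0 K | `[< T (ideal i) >]].
have [u [su u0 uP]] := small_ball_exists m.+1 surjP.
have [v [sv v0 vQ]] := small_ball_exists m.+1 surjQ.
pose z := CodeSeq.code [:: u, v, m, size c & c].
have [zu zv] : entry z 0 = u /\ entry z 1 = v by rewrite /z CodeSeq.codeK.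
have [zm zK] : entry z 2 = m /\ entry z 3 = size c by rewrite /z CodeSeq.codeK.
have zc i : entry z (4 + i) = nth 0%N c i by rewrite /z CodeSeq.codeK.
have NE : 2 ^- N = e + e :> R by rewrite exp2NS /e; lra.
have he : h / 2 <= e.
  rewrite /h exp2NS /e mulrAC divff// mul1r lef_pV2 ?posrE ?exprn_gt0//.
  by rewrite ler_weXn2l ?ler1n// /m; lia.
have h16 : 2 ^- (N + M) = 16 * h :> R.
  by rewrite /h /m addn4 4!exp2NS; lra.
have small_rad q : rat_lt q 1 m.+1 -> ratr (rat_num q) < h / 2.
  by rewrite -(rat_ltE R) div1r => /lt_le_trans; apply; rewrite /h (exp2NS m); lra.
exists z; apply/and5P; rewrite zu zv zm; split => //; first by rewrite /m; lia.
- pose S : set X := \bigcup_(i in [set i | (i < size c)%N])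
    [set x : X | mdist (ideal (nth 0%N c i) : X) x < 11 * h].
  have oS : open S by apply: bigcup_open => i _; exact: open_mdist_ball.
  have mS := open_measurable_borel oS.
  apply: (ideal_prob_light (A := S)) => //.
    move=> l /close_to_mdist[i]; rewrite zK zm zc => ic li; exists i => //=.
    by rewrite metric_sym.
  have sh := small_rad _ su.
  apply: le_trans (prokhorov_lt uP mS) _; rewrite NE EFinD; apply: leeD; last first.
    by rewrite lee_fin (le_trans (ltW sh)).
  apply: (@le_trans _ _ (P (thickening (2 ^- (N + M)) C : set (borel X)))).
    rewrite le_measure ?inE//; try exact: measurable_thickening.
    move=> x [y [i /= ic iy] xy].
    have /asboolP[w Cw iw] : `[< T (ideal (nth 0%N c i)) >].
      by have := mem_nth 0%N ic; rewrite mem_filter => /andP[].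
    exists w => //; rewrite h16.
    have := metric_triangle x y w.
    have := metric_triangle y (ideal (nth 0%N c i) : X) w.
    rewrite (metric_sym y (ideal _)); move: iy iw xy sh.
    by lra.
  by have := PM (N + M)%N (leq_addl _ _); rewrite PC add0e => /ltW.
- pose S : set X := \bigcup_(i in [set i | (i < size c)%N])
    [set x : X | mdist (ideal (nth 0%N c i) : X) x < h].
  have oS : open S by apply: bigcup_open => i _; exact: open_mdist_ball.
  have mS : measurable (~` S : set (borel X)).
    by apply: measurableC; exact: open_measurable_borel.
  apply: (ideal_prob_light (A := ~` S)) => //.
    move=> l /negP nl [i /= ic il]; apply: nl.
    apply: (@mdist_close_to 1 l z i); rewrite ?zK// zm zc mul1r metric_sym.
    exact: il.
  have sh := small_rad _ sv.
  apply: le_trans (prokhorov_lt vQ mS) _; rewrite NE EFinD; apply: leeD; last first.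
    by rewrite lee_fin (le_trans (ltW sh)).
  have mU : measurable (\bigcup_(i < K) F i) by exact: bigcup_measurable.
  apply: (@le_trans _ _ (Q (~` \bigcup_(i < K) F i))).
    rewrite le_measure ?inE//; [exact: measurable_thickening|exact: measurableC|].
    move=> x [y Sy xy] [i /= iK]; rewrite /F; case: asboolP => // Ti ix; apply: Sy.
    have ic : i \in c by rewrite mem_filter mem_iota/= iK andbT; apply/asboolP.
    exists (index i c); first by rewrite /= index_mem.
    rewrite /= nth_index//; have := metric_triangle (ideal i : X) x y.
    by move: ix xy sh; rewrite /B/=; lra.
  rewrite probability_setC//.
  have : (Q (C : set (borel X)) <= Q (\bigcup_i F i))%E.
    rewrite le_measure ?inE//; first exact: bigcup_measurable.
    move=> x Cx; have [i ix] := ideal_approx x h20; exists i => //.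
    by rewrite /F asboolT//; exists x.
  move=> /le_lt_trans/(_ QK)/ltW QCK; move: QC; rewrite QV => QC.
  have : (1 <= Q (\bigcup_(i < K) F i) + e%:E)%E.
    apply: le_trans QC _; rewrite [e in leRHS](splitr e) EFinD addeA.
    exact: leeD.
  by rewrite leeBlDr ?fin_num_measure// addeC.
Qed.
End search.

Lemma effectively_orthogonal_orthogonal (R : realType) (X : constructiveMetricType R)
    (t : X -> prob X -> \bar R) (P Q : prob X) : uniform_test t ->
  effectively_orthogonal t P Q -> orthogonal_prob P Q.
Proof.
move=> ut eo; pose V : set (borel X) := [set x | t x P = +oo%E].
have [mV PV] := uniform_test_ae P ut; have [mW QW] := uniform_test_ae Q ut.
exists (~` V), V; split => //; first exact: measurableC.
- by rewrite setICl.
- by rewrite setUC setUv.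
- split=> //; apply/eqP; rewrite eq_le measure_ge0 andbT -QW.
  rewrite le_measure ?inE//; first exact: measurableC.
  move=> x Vx; have := eo x; rewrite /uniformly_random => nr.
  apply/eqP; rewrite -leye_eq leNgt; apply/negP => tQ; apply: nr; split => //.
  by rewrite ltey; apply/eqP.
Qed.

Lemma orthogonal_effectively_orthogonal (R : realType) (X : constructiveMetricType R)
    (t : X -> prob X -> \bar R) (P Q : prob X) : universal_uniform_test t ->
  computable_prob P -> computable_prob Q ->
  orthogonal_prob P Q -> effectively_orthogonal t P Q.
Proof.
move=> ut cP cQ [U [V [mU mV UV0 UVT [PV QU]]]] x [tP tQ].
have QV : Q V = 1%E.
  have -> : V = ~` U.
    apply/seteqP; split => [y Vy Uy|y Uy].
      by have : (U `&` V) y by []; rewrite UV0.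
    by have : (U `|` V) y by [rewrite UVT]; case.
  by rewrite probability_setC// QU sube0.
have [jP [sP [rjP rsP Pb surjP]]] := computable_prob_enum cP.
have [jQ [sQ [rjQ rsQ Qb surjQ]]] := computable_prob_enum cQ.
have [dd [rdd ddE]] := mdist_ideal_approx X.
have gex n : exists z, good dd jP sP jQ sQ n z.
  exact: (good_exists ddE surjP surjQ n mV PV QV).
pose h n := ex_minn (gex n).
have hg n : good dd jP sP jQ sQ n (h n) by rewrite /h; case: ex_minnP.
have rh : rc 1 (fun v => h (nth 0%N v 0)).
  have rg := rcb_good rdd rjP rsP rjQ rsQ.
  have v0 : rc 2 (nth 0%N ^~ 0%N) by exact: rc_var.
  have v1 : rc 2 (nth 0%N ^~ 1%N) by exact: rc_var.
  apply: (rc_min (rcb_not (rc_comp2 rg v1 v0))) => -[//|n []]// _ /=; split.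
    by rewrite hg.
  move=> z; rewrite /h; case: ex_minnP => k _ kmin zk.
  by case: (boolP (good _ _ _ _ _ _ _)) => // /kmin; rewrite leqNgt zk.
have rz i : rc 1 (fun v => entry (h (nth 0%N v 0)) i).
  by apply: rc_nth => //; exact: rc_const.
have rc6 : rcb 2 (fun v => close_to dd 6 (nth 0%N v 1) (h (nth 0%N v 0))).
  apply: (rc_comp2 (rcb_close_to rdd 6)); first exact: rc_var.
  by apply: (rc_comp1 rh); exact: rc_var.
have in_io : ~ forall N, exists n, (N <= n)%N /\ balls_in dd (h n) x.
  move=> io; suff : t x P = +oo%E by move=> tPoo; rewrite /uniformly_random tPoo in tP.
  apply: (@sequence_test_infty R X (fun n a => close_to dd 6 a (h n))
    (fun n => entry (h n) 2) (fun n => jP (entry (h n) 0))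
    (fun n => sP (entry (h n) 0))) => //.
  - exact: rc_comp1 rjP (rz 0%N).
  - exact: rc_comp1 rsP (rz 0%N).
  - by move=> n P'; exact: (balls_in_small ddE (hg n)).
have out_io : ~ forall N, exists n, (N <= n)%N /\ balls_out dd (h n) x.
  move=> io; suff : t x Q = +oo%E by move=> tQoo; rewrite /uniformly_random tQoo in tQ.
  apply: (@sequence_test_infty R X (fun n a => ~~ close_to dd 6 a (h n))
    (fun n => entry (h n) 2) (fun n => jQ (entry (h n) 1))
    (fun n => sQ (entry (h n) 1))) => //.
  - exact: rcb_not.
  - exact: rc_comp1 rjQ (rz 1%N).
  - exact: rc_comp1 rsQ (rz 1%N).
  - by move=> n P'; exact: (balls_out_small ddE (hg n)).
apply: out_io => N; apply: contrapT => nout; apply: in_io => M.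
exists (maxn M N); split; first exact: leq_maxl.
have [//|out] := balls_in_out dd (h (maxn M N)) x.
by exfalso; apply: nout; exists (maxn M N); split => //; exact: leq_maxr.
Qed.

Theorem theorem25 (R : realType) (X : constructiveMetricType R)
    (t : X -> prob X -> \bar R) (ht : universal_uniform_test t)
    (P Q : prob X) (hP : computable_prob P) (hQ : computable_prob Q) :
  orthogonal_prob P Q <-> effectively_orthogonal t P Q.
Proof.
split; first exact: orthogonal_effectively_orthogonal.
exact: effectively_orthogonal_orthogonal ht.1.
Qed.
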